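(* Let $P=[p_{ij}]$ be the $m\times m$ transition matrix of a finite irreducible discrete time Markov chain with stationary probability vector $\pi^T=(\pi_1,\dots,\pi_m)$ and column sum vector $c^T=(c_1,\dots,c_m)$, $c_j=\sum_{i=1}^m p_{ij}$, and let $H=[h_{ij}]=[I-P+ec^T]^{-1}$, where $e$ is the column vector of ones. Then $$c^TH=\pi^T,\quad\text{implying}\quad \pi_j=\sum_{i=1}^m c_ih_{ij}\ \text{ for all } j=1,\dots,m,$$ and $$He=\tfrac1m e,\quad\text{implying}\quad h_{i\bullet}\equiv\sum_{j=1}^m h_{ij}=\tfrac1m\ \text{ for all } i=1,\dots,m,$$ and hence $$c^THe=1,\quad\text{with } c^Te=\sum_{i=1}^m c_i=m.$$
   Context: The chain has state space $\{1,\dots,m\}$. $P$ is row-stochastic: $p_{ij}\ge 0$ and $\sum_{j=1}^m p_{ij}=1$ for all $i$. The stationary probability vector is the unique $\pi$ with $\pi^TP=\pi^T$ and $\pi^Te=1$. The matrix $I-P+ec^T$ is nonsingular, so $H$ is well defined. *)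

(* Defs.v *)
From HB Require Import structures.
From mathcomp Require Import all_boot all_order all_algebra.
Set Implicit Arguments.
Unset Strict Implicit.
Unset Printing Implicit Defensive.
Import Order.TTheory GRing.Theory Num.Theory.
Local Open Scope ring_scope.

(* The states 1, ..., m are represented by the ordinals 0, ..., m-1. *)

Definition row_stochastic (R : realFieldType) (m : nat) (P : 'M[R]_m) : Prop :=
  (forall i j, 0 <= P i j) /\ (forall i, \sum_(j < m) P i j = 1).

(* Allowing k = 0 changes nothing for a row-stochastic P: the diagonal case
   follows from the off-diagonal ones, and from P = 1 when m = 1. *)
Definition irreducible_chain (R : realFieldType) (m : nat) (P : 'M[R]_m) :
    Prop :=
  forall i j, exists k : nat, 0 < (P ^+ k) i j.

Definition ones (R : realFieldType) (m : nat) : 'cV[R]_m := const_mx 1.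

(* Nonnegativity of p is not required: for an irreducible row-stochastic P
   these two equations already determine p, and its entries are positive.
   The second one also rules out m = 0. *)
Definition stationary_vector (R : realFieldType) (m : nat) (P : 'M[R]_m)
    (p : 'cV[R]_m) : Prop :=
  p^T *m P = p^T /\ p^T *m ones R m = 1%:M.

Definition col_sums (R : realFieldType) (m : nat) (P : 'M[R]_m) : 'cV[R]_m :=
  \col_j \sum_(i < m) P i j.

Definition Hbase (R : realFieldType) (m : nat) (P : 'M[R]_m) : 'M[R]_m :=
  1%:M - P + ones R m *m (col_sums P)^T.

(* [invmx] returns its argument on a singular matrix, so [Hmat P] is the
   inverse only once [Hbase P \in unitmx] is known. *)
Definition Hmat (R : realFieldType) (m : nat) (P : 'M[R]_m) : 'M[R]_m :=
  invmx (Hbase P).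

(* Main.v *)
Require Import Defs.
From mathcomp Require Import all_boot all_order all_algebra.
Set Implicit Arguments.
Unset Strict Implicit.
Unset Printing Implicit Defensive.
Import Order.TTheory GRing.Theory Num.Theory.
Local Open Scope ring_scope.

(** A vector [x] with [(I - P + e c^T) x = 0] satisfies [c^T x = 0] (multiply on
    the left by [p^T]), hence [P x = x]. By the maximum principle [x] is
    constant, and then [c^T x = 0] together with [c^T e = m] forces [x = 0], so
    that [I - P + e c^T] is nonsingular. The identities come from
    [p^T (I - P + e c^T) = c^T] and [(I - P + e c^T) e = m e]. *)

Lemma expmx_fixed (R : pzSemiRingType) (m : nat) (P : 'M[R]_m) (x : 'cV[R]_m)
    (k : nat) :
  P *m x = x -> P ^+ k *m x = x.
Proof.
move=> Px; elim: k => [|k IHk]; first by rewrite expr0 mul1mx.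
by rewrite exprSr -mulmxE -mulmxA Px.
Qed.

Lemma expmx_ge0 (R : numDomainType) (m : nat) (P : 'M[R]_m) (k : nat) :
  (forall i j, 0 <= P i j) -> forall i j, 0 <= (P ^+ k) i j.
Proof.
move=> P_ge0; elim: k => [|k IHk] i j; first by rewrite expr0 mxE ler0n.
by rewrite exprS mxE sumr_ge0 // => l _; rewrite mulr_ge0.
Qed.

Section IrreducibleChain.

Variables (R : realFieldType) (m : nat) (P : 'M[R]_m).

Lemma mulmx_ones (n : nat) (A : 'M[R]_(n, m)) i j :
  (A *m ones R m) i j = \sum_(l < m) A i l.
Proof. by rewrite mxE; apply: eq_bigr => l _; rewrite mxE mulr1. Qed.

Lemma stochastic_mul_ones : row_stochastic P -> P *m ones R m = ones R m.
Proof. by case=> _ P1; apply/matrixP => i j; rewrite mulmx_ones P1 mxE. Qed.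

(** Both sides count the total of all entries of [P]: exchanging the two sums gives [m] row sums,
    each equal to 1. *)
Lemma sum_col_sums :
  row_stochastic P -> \sum_(i < m) col_sums P i 0 = m%:R.
Proof.
case=> _ P1; under eq_bigr do rewrite mxE.
by rewrite exchange_big (eq_bigr _ (fun i _ => P1 i)) sumr_const card_ord.
Qed.

Lemma tr_col_sums_mul_ones :
  row_stochastic P -> (col_sums P)^T *m ones R m = m%:R%:M.
Proof.
move=> Pst; apply/matrixP => i j; rewrite !ord1 mulmx_ones mxE eqxx mulr1n.
by rewrite -sum_col_sums //; apply: eq_bigr => l _; rewrite mxE.
Qed.

(** Maximum principle: where [x] is maximal, its value is a weighted mean of all values, so every
    state of positive weight attains the maximum; irreducibility reaches each state by some power of
    [P]. *)
Lemma harmonic_const (x : 'cV[R]_m) :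
  row_stochastic P -> irreducible_chain P -> P *m x = x ->
  exists a, x = a *: ones R m.
Proof.
move=> Pst Pirr Px; have [i1 _|m0] := pickP (fun _ : 'I_m => true); last first.
  (* With no states, any scalar would do. *)
  by exists 0; apply/matrixP => i; have := m0 i.
have [i0 _ x_max] := @arg_maxP _ _ _ i1 xpredT (fun i => x i 0) isT.
exists (x i0 0); apply/matrixP => j l; rewrite !ord1 !mxE mulr1.
have [k Pk_gt0] := Pirr i0 j.
have term_ge0 l' : true -> 0 <= (P ^+ k) i0 l' * (x i0 0 - x l' 0).
  move=> _; rewrite mulr_ge0 ?subr_ge0 //; last exact: x_max.
  by apply: expmx_ge0; case: Pst.
have /eqP : \sum_(l' < m) (P ^+ k) i0 l' * (x i0 0 - x l' 0) = 0.
  (* [P ^+ k] fixes both [ones R m] and [x], so each half of the difference sums to [x i0 0]. *)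
  under eq_bigr do rewrite mulrBr.
  rewrite sumrB -mulr_suml -(mulmx_ones _ i0 0).
  rewrite expmx_fixed ?stochastic_mul_ones //.
  have /matrixP/(_ i0 0) := expmx_fixed k Px; rewrite !mxE => ->.
  by rewrite mul1r subrr.
(* Nonnegative terms with sum zero all vanish; at [j] the weight is positive, so the other factor is
   zero. *)
rewrite psumr_eq0 // => /allP /(_ j (mem_index_enum j)).
by rewrite /= mulf_eq0 gt_eqF //= subr_eq0 => /eqP.
Qed.

(** For [m = 0] the normalisation would equate an empty sum with 1. This is what permits division by
    [m%:R]. *)
Lemma stationary_dim_gt0 (p : 'cV[R]_m) : stationary_vector P p -> (0 < m)%N.
Proof.
case=> _ /matrixP/(_ 0 0); rewrite mulmx_ones mxE eqxx.
case: (posnP m) => // m0; rewrite big1 => [/eqP|i _]; first by rewrite eq_sym oner_eq0.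
by have := ltn_ord i; rewrite {2}m0.
Qed.

Lemma stationary_mul_Hbase (p : 'cV[R]_m) :
  stationary_vector P p -> p^T *m Hbase P = (col_sums P)^T.
Proof.
case=> pP pe.
by rewrite /Hbase mulmxDr mulmxBr mulmx1 pP subrr add0r mulmxA pe mul1mx.
Qed.

Lemma Hbase_mul_ones :
  row_stochastic P -> Hbase P *m ones R m = m%:R *: ones R m.
Proof.
move=> Pst; rewrite /Hbase mulmxDl mulmxBl mul1mx stochastic_mul_ones // subrr.
by rewrite add0r -mulmxA tr_col_sums_mul_ones // mul_mx_scalar.
Qed.

Lemma Hbase_unit (p : 'cV[R]_m) :
  row_stochastic P -> irreducible_chain P -> stationary_vector P p ->
  Hbase P \in unitmx.
Proof.
move=> Pst Pirr pst; rewrite -unitmx_tr unitmxE unitfE.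
(* [det0P] yields a row vector in a left kernel; applied to the transpose of [Hbase P], it gives the
   column [x] with [Hbase P *m x = 0]. *)
apply/det0P => -[v v_neq0 /(congr1 trmx)].
rewrite trmx_mul trmxK trmx0; set x := v^T => Hx.
have cx : (col_sums P)^T *m x = 0.
  by rewrite -(stationary_mul_Hbase pst) -mulmxA Hx mulmx0.
have Px : P *m x = x.
  apply/esym/eqP; rewrite -subr_eq0 -Hx /Hbase mulmxDl mulmxBl mul1mx.
  by rewrite -mulmxA cx mulmx0 addr0.
have [a xE] := harmonic_const Pst Pirr Px.
move: cx; rewrite xE -scalemxAr tr_col_sums_mul_ones // => /matrixP/(_ 0 0).
rewrite !mxE eqxx mulr1n => /eqP; rewrite mulf_eq0 pnatr_eq0.
rewrite (gtn_eqF (stationary_dim_gt0 pst)) orbF => /eqP a0.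
by case/eqP: v_neq0; rewrite -[v]trmxK -/x xE a0 scale0r trmx0.
Qed.

End IrreducibleChain.

Theorem theorem1 (R : realFieldType) (m : nat) (P : 'M[R]_m) (p : 'cV[R]_m)
    (P_stochastic : row_stochastic P) (P_irreducible : irreducible_chain P)
    (p_stationary : stationary_vector P p) :
  let e := ones R m in
  let c := col_sums P in
  let H := Hmat P in
  Hbase P \in unitmx
  /\ (c^T *m H = p^T /\ (forall j, p j 0 = \sum_(i < m) c i 0 * H i j))
  /\ (H *m e = m%:R^-1 *: e /\ (forall i, \sum_(j < m) H i j = m%:R^-1))
  /\ (c^T *m H *m e = 1%:M
      /\ c^T *m e = m%:R%:M /\ \sum_(i < m) c i 0 = m%:R).
Proof.
move=> e c H.
have Hu : Hbase P \in unitmx by apply: (@Hbase_unit _ _ _ p).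
have m_neq0 : m%:R != 0 :> R.
  by rewrite pnatr_eq0 -lt0n (stationary_dim_gt0 p_stationary).
have cH : c^T *m H = p^T.
  by rewrite -(stationary_mul_Hbase p_stationary) mulmxK.
have He : H *m e = m%:R^-1 *: e.
  (* It suffices that [m%:R *: (H *m e) = e]; the scalar moves inside, where [m%:R *: e] is
     [Hbase P *m e], and [H] cancels [Hbase P]. *)
  apply: (canRL (scalerK m_neq0)).
  by rewrite scalemxAr -(Hbase_mul_ones P_stochastic) mulKmx.
split=> //; split; [split=> // j | split; [split=> // i | split]].
- have /matrixP/(_ 0 j) := cH; rewrite !mxE => <-.
  by apply: eq_bigr => i _; rewrite mxE.
- by rewrite -(mulmx_ones _ i 0) He !mxE mulr1.
- by rewrite cH; case: p_stationary.
- by split; [exact: tr_col_sums_mul_ones | exact: sum_col_sums].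
Qed.
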